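(* A finite simple graph $G$ is separable if and only if $G$ falls into one of the following four categories: (1) $G$ is not connected; (2) $G$ is a tree; (3) $G$ is an elementary cycle; (4) $G$ is an elementary cycle with arborescences.
   Context: A graph $G=(V,E)$ is separable if there exist non-negative real weights $w(e)$, $e\in E$, and a threshold $\alpha\in\mathbb{R}$ such that for every $E'\subseteq E$: $\sum_{e\in E'}w(e)\ge\alpha$ if and only if the spanning subgraph $(V,E')$ is connected. An elementary cycle with arborescences is a graph obtained from an elementary cycle by attaching one or several trees hanging from vertices of the cycle (a connected graph with exactly one cycle). *)

(* Defs.v *)
From HB Require Import structures.
From mathcomp Require Import all_boot all_order all_algebra.
From mathcomp Require Import reals.

Set Implicit Arguments.
Unset Strict Implicit.
Unset Printing Implicit Defensive.

Import Order.TTheory GRing.Theory Num.Theory.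
Local Open Scope ring_scope.

(* A graph is a pair (V, E) inside an ambient finite type T; an edge is the
   two-element set of its endpoints. *)
Definition simple_graph (T : finType) (V : {set T}) (E : {set {set T}}) : Prop :=
  forall a, a \in E -> a \subset V /\ #|a| = 2%N.

Definition adj (T : finType) (E : {set {set T}}) : rel T :=
  [rel x y | [set x; y] \in E].

(* When (V, E) is a simple graph, adj E never leaves V from a vertex of V, so
   paths need not be constrained further. The null graph is connected. *)
Definition graph_connected (T : finType) (V : {set T}) (E : {set {set T}}) : Prop :=
  {in V &, forall x y, connect (adj E) x y}.

(* The bound 3 excludes traversing a single edge back and forth. *)
Definition acyclic (T : finType) (E : {set {set T}}) : Prop :=
  forall c : seq T, (3 <= size c)%N -> ~ ucycle (adj E) c.

Definition tree (T : finType) (V : {set T}) (E : {set {set T}}) : Prop :=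
  [/\ simple_graph V E, graph_connected V E & acyclic E].

Definition elementary_cycle (T : finType) (V : {set T}) (E : {set {set T}}) : Prop :=
  exists c : seq T,
    [/\ (3 <= size c)%N, uniq c, V = [set:: c]
      & E = [set [set x; next c x] | x in c]].

(* The i-th tree (VT i, ET i) has at least one edge and is glued to the cycle
   (VC, EC) at the single vertex r i; distinct trees are disjoint except that
   several of them may hang from the same vertex of the cycle. *)
Definition cycle_with_arborescences
    (T : finType) (V : {set T}) (E : {set {set T}}) : Prop :=
  exists (VC : {set T}) (EC : {set {set T}}) (n : nat) (r : 'I_n -> T)
         (VT : 'I_n -> {set T}) (ET : 'I_n -> {set {set T}}),
    [/\ elementary_cycle VC EC,
        (0 < n)%N,
        forall i, [/\ tree (VT i) (ET i), (1 < #|VT i|)%N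
                    & VT i :&: VC = [set r i]],
        forall i j, i != j -> VT i :&: VT j \subset VC
      & V = VC :|: \bigcup_(i < n) VT i /\ E = EC :|: \bigcup_(i < n) ET i].

Definition separable (R : realType) (T : finType)
    (V : {set T}) (E : {set {set T}}) : Prop :=
  exists (w : {set T} -> R) (alpha : R),
    (forall a, a \in E -> 0 <= w a) /\
    (forall E' : {set {set T}}, E' \subset E ->
       (\sum_(a in E') w a >= alpha <-> graph_connected V E')).

(* Main.v *)
(* A connected graph is separable exactly when no two distinct edges can be
   removed together without disconnecting it. If this holds, weight 2 on bridges,
   weight 1 elsewhere and the threshold w(E) - 1 separate. Conversely, take a
   minimal connected H in which some pair is removable; no triple is removable
   in H. Adding cuts modulo 2 shows that every cycle avoiding some non-bridge
   has two edges that cannot be removed together. This produces distinct a, a', b, b'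
   such that the pairs {a, b}, {a', b'} are removable and {a, a'}, {b, b'} are
   not, and the two removable pairs weigh as much as the two others: contradiction.
   Without removable pairs, deleting the edges of a cycle C leaves a forest each
   component of which meets C in one vertex: these are the arborescences. *)

Require Import Defs.
From HB Require Import structures.
From mathcomp Require Import all_boot all_order all_algebra.
From mathcomp Require Import reals.
From mathcomp Require Import boolp lra.

Set Implicit Arguments.
Unset Strict Implicit.
Unset Printing Implicit Defensive.

(** * Connectivity of spanning subgraphs, and cuts modulo 2 *)

Section Connectivity.
Variables (T : finType) (V : {set T}).
Implicit Types (E F H X Y : {set {set T}}) (S : {set T}) (a b c e : {set T}).

Definition connectedb E : bool :=
  [forall x in V, forall y in V, connect (adj E) x y].

Lemma connectedP E : reflect (graph_connected V E) (connectedb E).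
Proof.
apply: (iffP forall_inP) => [h x y Vx Vy|h x Vx].
  by move/forall_inP: (h x Vx); apply.
by apply/forall_inP => y Vy; apply: h.
Qed.

Lemma connect_adj_sym E : connect_sym (adj E).
Proof. by apply: sym_connect_sym => x y; rewrite /adj /= setUC. Qed.

Lemma connect_adjS E F x y :
  E \subset F -> connect (adj E) x y -> connect (adj F) x y.
Proof.
move=> sEF; apply: connect_sub => u v uv.
by apply: connect1; apply: (subsetP sEF).
Qed.

Lemma connectedS E F : E \subset F -> connectedb E -> connectedb F.
Proof.
move=> sEF /connectedP cE; apply/connectedP => x y Vx Vy.
exact: connect_adjS sEF (cE _ _ Vx Vy).
Qed.

Lemma simple_graphS E F : F \subset E -> simple_graph V E -> simple_graph V F.
Proof. by move=> /subsetP sFE sE a /sFE /sE. Qed.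

Lemma simple_edge E a : simple_graph V E -> a \in E ->
  exists x y, [/\ x != y, a = [set x; y], x \in V & y \in V].
Proof.
move=> sE /sE [sa /eqP /cards2P [x [y [xy aE]]]]; exists x, y.
by move: sa; rewrite aE subUset !sub1set => /andP [].
Qed.

Lemma adj_neq E x y : simple_graph V E -> adj E x y -> x != y.
Proof. by move=> sE /sE [_ /eqP]; rewrite cards2; case: (x != y). Qed.

Lemma adj_V E x y : simple_graph V E -> adj E x y -> x \in V /\ y \in V.
Proof. by move=> sE /sE [+ _]; rewrite subUset !sub1set => /andP. Qed.

Lemma closed_adj E (A : {pred T}) :
  (forall x y, adj E x y -> x \in A -> y \in A) -> closed (adj E) A.
Proof. exact: (intro_closed (connect_adj_sym E)). Qed.

(** Every passage through the deleted edge is rerouted along the remaining connection between its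
    ends. *)
Lemma connectedD1 E x y : connectedb E ->
  connect (adj (E :\ [set x; y])) x y -> connectedb (E :\ [set x; y]).
Proof.
move=> /connectedP cE xy; apply/connectedP => u v Vu Vv.
apply: connect_sub (cE u v Vu Vv) => p q pq.
have [eq_pq|neq] := eqVneq [set p; q] [set x; y]; last first.
  by apply: connect1; rewrite /adj /= in_setD1 neq.
have : p \in [set x; y] by rewrite -eq_pq set21.
have : q \in [set x; y] by rewrite -eq_pq set22.
have yx : connect (adj (E :\ [set x; y])) y x by rewrite connect_adj_sym.
by rewrite !inE => /orP [] /eqP -> /orP [] /eqP ->.
Qed.

(** The coboundary of [S]: on two-element edges, odd intersection means exactly one end in [S]. The
    parity form makes it additive modulo 2. *)
Definition cut S E := [set a in E | odd #|a :&: S|].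

Lemma in_cut S E a : (a \in cut S E) = (a \in E) && odd #|a :&: S|.
Proof. by rewrite inE. Qed.

Lemma odd_pair x y S : x != y ->
  odd #|[set x; y] :&: S| = (x \in S) (+) (y \in S).
Proof.
move=> xy; rewrite setIUl cardsU.
have ->: [set x] :&: S :&: ([set y] :&: S) = set0.
  apply/setP => z; rewrite !inE; have [->|//] := eqVneq z x.
  by rewrite (negbTE xy) /= andbF.
have c1 z : #|[set z] :&: S| = (z \in S).
  case: (boolP (z \in S)) => zS; last first.
    by apply: eq_card0 => t; rewrite !inE; case: eqP => // ->; exact/negbTE.
  by rewrite (setIidPl _) ?cards1 ?sub1set.
by rewrite !c1 cards0 subn0 oddD !oddb.
Qed.

(** Without its cut, [S] is closed under adjacency, so the two ends of a deleted cut edge can no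
    longer be joined. *)
Lemma cut_disconnected E X S : simple_graph V E -> cut S E != set0 ->
  cut S E \subset X -> ~~ connectedb (E :\: X).
Proof.
move=> sE /set0Pn [a]; rewrite inE => /andP [aE oa] /subsetP sub.
have [x [y [xy ae Vx Vy]]] := simple_edge sE aE.
apply/connectedP => cEX.
have cl : closed (adj (E :\: X)) S.
  apply: closed_adj => u v; rewrite /adj /= inE => /andP [nX uv] uS.
  apply: contraNT nX => vS; apply: sub; rewrite inE uv odd_pair ?uS ?vS //.
  exact: adj_neq sE uv.
move: oa; rewrite ae odd_pair //.
by rewrite (closed_connect cl (cEX x y Vx Vy)) addbb.
Qed.

Lemma disconnected_cut E X : simple_graph V E -> connectedb E ->
  ~~ connectedb (E :\: X) -> exists2 S, cut S E != set0 & cut S E \subset X.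
Proof.
move=> sE cE; rewrite negb_forall_in => /exists_inP [x Vx].
rewrite negb_forall_in => /exists_inP [y Vy nxy].
(* The component of [x] after the deletion: edges leaving it lie in [X], and some edge does leave it
   because [E] joins [x] to [y]. *)
exists [set z | connect (adj (E :\: X)) x z]; last first.
  apply/subsetP => a; rewrite inE => /andP [aE].
  have [u [v [uv ae Vu Vv]]] := simple_edge sE aE.
  apply: contraLR => aX; rewrite ae odd_pair // !inE.
  have cuv : connect (adj (E :\: X)) u v.
    by apply: connect1; rewrite /adj /= -ae inE aX.
  by rewrite (same_connect_r (connect_adj_sym _) cuv) addbb.
apply: contra nxy => /eqP c0.
have cl : closed (adj E) [set z | connect (adj (E :\: X)) x z].
  apply: closed_adj => u v uv uS.
  have := in_set0 [set u; v]; rewrite -c0 in_cut odd_pair ?(adj_neq sE uv) //.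
 
  by rewrite -[_ \in E]/(adj E u v) uv uS => /negbFE.
move/connectedP: cE => /(_ x y Vx Vy) /(closed_connect cl).
by rewrite !inE connect0 => <-.
Qed.

(** Some nonempty cut lies inside [X]; if it missed an edge [a], then [X :\ a] would already
    disconnect. *)
Lemma minimal_disconnecting_cut E X : simple_graph V E -> X != set0 ->
  ~~ connectedb (E :\: X) -> {in X, forall a, connectedb (E :\: (X :\ a))} ->
  exists S, cut S E = X.
Proof.
move=> sE /set0Pn [a0 Xa0] dX minX.
have cE : connectedb E by apply: connectedS (minX a0 Xa0); apply: subsetDl.
have [S S0 sub] := disconnected_cut sE cE dX.
exists S; apply/eqP; rewrite eqEsubset sub; apply/subsetP => a Xa.
apply: contraT => aS.
suff : ~~ connectedb (E :\: (X :\ a)) by rewrite minX.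
by apply: cut_disconnected S0 _ => //; apply/subsetD1P.
Qed.

(** Additivity of the coboundary modulo 2: vertices common to [S] and [S'] are counted twice on the
    right. *)
Lemma cutD E S S' a :
  a \in E -> (a \in cut ((S :\: S') :|: (S' :\: S)) E)
           = (a \in cut S E) (+) (a \in cut S' E).
Proof.
move=> aE; rewrite !in_cut aE /= -oddD.
have eC A B : #|a :&: A| = #|a :&: A :&: B| + #|a :&: (A :\: B)|.
  by rewrite -(cardsID B) setIDA.
rewrite (eC S S') (eC S' S) setIUr cardsU.
have ->: a :&: (S :\: S') :&: (a :&: (S' :\: S)) = set0.
  apply/setP => z; rewrite !inE.
  by case: (z \in S); case: (z \in S'); rewrite ?andbF.
rewrite cards0 subn0 -!setIA [S' :&: S]setIC !oddD.
by case: (odd _); case: (odd _); case: (odd _).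
Qed.

Lemma cut_symdiff_disconnected E S S' X : simple_graph V E ->
  (forall a, a \in E -> (a \in cut S E) (+) (a \in cut S' E) -> a \in X) ->
  (exists2 a, a \in E & (a \in cut S E) (+) (a \in cut S' E)) ->
  ~~ connectedb (E :\: X).
Proof.
move=> sE sub [a aE aS].
apply: (@cut_disconnected _ _ ((S :\: S') :|: (S' :\: S))) => //.
  by apply/set0Pn; exists a; rewrite cutD.
apply/subsetP => b bS; have bE : b \in E by move: bS; rewrite inE => /andP[].
by apply: sub => //; rewrite -cutD.
Qed.

End Connectivity.

(** * Cycles and edges whose removal keeps the graph connected *)

Section Cycles.
Variables (T : finType).
Implicit Types (V S : {set T}) (E F : {set {set T}}) (a b : {set T}) (c : seq T).

Definition cycle_edges c : {set {set T}} := [set [set x; next c x] | x in c].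

Lemma cycle_edge c x : x \in c -> [set x; next c x] \in cycle_edges c.
Proof. exact: (imset_f (fun x => [set x; next c x])). Qed.

Lemma cycle_edge_sub c a : a \in cycle_edges c -> a \subset [set:: c].
Proof.
by case/imsetP => x xc ->; rewrite subUset !sub1set !inE mem_next xc.
Qed.

Lemma cycle_edges_sub c E : cycle (adj E) c -> cycle_edges c \subset E.
Proof. by move=> cc; apply/subsetP => a /imsetP [x xc ->]; exact: (next_cycle cc). Qed.

Lemma next_next_neq c x : 2 < size c -> uniq c -> x \in c ->
  next c (next c x) != x.
Proof.
move=> + uc xc; have [i s rc] := rot_to xc.
(* After rotating [x] to the front, [next c (next c x)] is the third entry. *)
rewrite -(size_rot i c) -!(next_rot i uc); move: uc.
rewrite -(rot_uniq i) rc; case: s {rc} => [|y [|z s]] //= /and3P [].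
rewrite !inE !negb_or eqxx => /and3P [/negbTE xy xz _] _ _ _.
by rewrite [y == x]eq_sym xy eqxx eq_sym.
Qed.

(** Distinct vertices giving the same edge would be successors of each other, closing the cycle
    after two steps. *)
Lemma cycle_edge_inj c : 2 < size c -> uniq c ->
  {in c &, injective (fun x => [set x; next c x])}.
Proof.
move=> c2 uc x y xc yc /= exy.
have : x \in [set y; next c y] by rewrite -exy set21.
have : y \in [set x; next c x] by rewrite exy set21.
rewrite !inE => /orP [/eqP -> //|/eqP yx] /orP [/eqP // |/eqP xy].
by have := next_next_neq c2 uc xc; rewrite -yx -xy eqxx.
Qed.

Lemma card_cycle_edges c : 2 < size c -> uniq c -> #|cycle_edges c| = size c.
Proof.
move=> c2 uc; rewrite card_in_imset; first by apply/card_uniqP.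
exact: cycle_edge_inj.
Qed.

(* The arc of c from the successor of y up to x: it avoids the edges leaving x
   and y, and for x = y it is the cycle minus the edge leaving x. *)
Lemma arc_connect c x y : uniq c -> x \in c -> y \in c ->
  connect (adj [set [set z; next c z] | z in [pred z in c | (z != x) && (z != y)]])
    (next c y) x.
Proof.
move=> uc xc yc; set F := [set _ | z in _].
have yc' : next c y \in c by rewrite mem_next.
have : fconnect (next c) (next c y) x.
  by rewrite (fconnect_cycle (cycle_next uc)).
move/iter_findex; set n := findex _ _ _ => xE.
(* The walk follows [next] from [next c y]. The second disjunct records that [x] has been met; on
   meeting [y] the walk is back at its start. *)
suff H m : (connect (adj F) (next c y) (iter m (next c) (next c y))) \/
           (connect (adj F) (next c y) x).
  by case: (H n); rewrite ?xE.
elim: m => [|m [IH|]]; [by left; exact: connect0| |by right].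
rewrite iterS; set z := iter m _ _ in IH *.
have zc : z \in c by rewrite /z; elim: (m) => //= k; rewrite mem_next.
have [<-|zx] := eqVneq z x; first by right.
have [->|zy] := eqVneq z y; first by left; exact: connect0.
left; apply: connect_trans IH _; apply: connect1.
by apply/imsetP; exists z; rewrite // !inE zc zx.
Qed.

Lemma cycle_edge_connect c x : 2 < size c -> uniq c -> x \in c ->
  connect (adj (cycle_edges c :\ [set x; next c x])) (next c x) x.
Proof.
move=> c2 uc xc; apply: connect_adjS (arc_connect uc xc xc).
apply/subsetP => _ /imsetP [z + ->]; rewrite !inE => /and3P [zc zx _].
rewrite cycle_edge // andbT; apply: contra zx => /eqP.
by move/cycle_edge_inj => ->.
Qed.

Lemma cycle_edge_removable V E c a : connectedb V E -> 2 < size c -> uniq c ->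
  cycle_edges c \subset E -> a \in cycle_edges c -> connectedb V (E :\ a).
Proof.
move=> cE c2 uc sE /imsetP [x xc ->]; apply: connectedD1 => //.
rewrite connect_adj_sym; apply: connect_adjS (cycle_edge_connect c2 uc xc).
exact: setSD.
Qed.

(** A simple path joining the ends of [a] without using [a] is closed into a cycle by [a]. *)
Lemma removable_edge_cycle V E a : simple_graph V E -> a \in E ->
  connectedb V (E :\ a) ->
  exists c, [/\ 2 < size c, uniq c, cycle (adj E) c & a \in cycle_edges c].
Proof.
move=> sE aE; have [u [v [uv ae Vu Vv]]] := simple_edge sE aE.
move/connectedP => /(_ v u Vv Vu) /connectP [p0 pp ue].
case: (shortenP pp) ue => p {}pp up _ ue {p0}.
exists (v :: p); split => //.
(* The cycle has at least three vertices: a path with a single edge would be [a] itself, which was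
   deleted. *)
- case: p pp ue {up} => [|x [|y p]] //=; first by move=> _ ue; rewrite ue eqxx in uv.
  by rewrite /adj /= => + xe; rewrite -xe !inE ae setUC eqxx.
- rewrite /= rcons_path -ue; apply/andP; split; last by rewrite /adj /= -ae.
  by apply: sub_path pp => x y; rewrite /adj /= inE => /andP [].
- have uc : u \in v :: p by rewrite ue mem_last.
  have := cycle_next up; rewrite /= rcons_path -ue => /andP [_ /eqP nu].
  by have := cycle_edge uc; rewrite nu ae.
Qed.

Lemma tree_edge_bridge V E a : tree V E -> a \in E -> ~~ connectedb V (E :\ a).
Proof.
move=> [sE cE aE] Ea; apply/negP => /(removable_edge_cycle sE Ea).
by case=> c [c2 uc cc _]; apply: (aE c c2); rewrite /ucycle cc.
Qed.

End Cycles.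

(** * Removable pairs in a graph without removable triples *)

Section TwoRemovableEdges.
Variables (T : finType) (V : {set T}) (H : {set {set T}}).
Hypothesis sH : simple_graph V H.
Implicit Types a b c e f : {set T}.

Let removable (X : {set {set T}}) := connectedb V (H :\: X).

Lemma removableS (X Y : {set {set T}}) : X \subset Y -> removable Y -> removable X.
Proof. by move=> sXY; apply: connectedS; apply: setDS. Qed.

(* Inseparable non-bridges are parallel elements of the cographic matroid; the
   cut {a, c} is the symmetric difference of the cuts {a, b} and {b, c}. *)
Lemma inseparable_trans a b c : a \in H -> a != b -> b != c -> a != c ->
  removable [set a] -> removable [set b] -> removable [set c] ->
  ~~ removable [set a; b] -> ~~ removable [set b; c] -> ~~ removable [set a; c].
Proof.
move=> aH ab bc ac ra rb rc nab nbc.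
have nonempty x y : [set x; y] != set0 :> {set {set T}}.
  by apply/set0Pn; exists x; rewrite set21.
have del x y : x != y -> [set x; y] :\ x = [set y].
  by move=> xy; rewrite setU1K // inE.
have [||S cS] := minimal_disconnecting_cut sH _ nab; first exact: nonempty.
  move=> x /set2P [] ->; first by rewrite del.
  by rewrite setUC del // eq_sym.
have [||S' cS'] := minimal_disconnecting_cut sH _ nbc; first exact: nonempty.
  move=> x /set2P [] ->; first by rewrite del.
  by rewrite setUC del // eq_sym.
apply: (@cut_symdiff_disconnected _ _ _ S S') => //; rewrite ?cS ?cS'.
  by move=> x _; rewrite !inE; case: (x == a); case: (x == b); case: (x == c).
by exists a; rewrite // !inE eqxx (negbTE ab) (negbTE ac).
Qed.

Hypothesis no_triple : forall a b c, a \in H -> b \in H -> c \in H ->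
  a != b -> b != c -> a != c -> ~~ removable [set a; b; c].

(* As the cuts {e, a, b} and {e, b, c} add up to {a, c}, the cographic matroid
   of rank two has at most three parallel classes. *)
Lemma inseparable_among_three a b c e :
  a \in H -> b \in H -> c \in H -> e \in H ->
  a != b -> b != c -> a != c -> a != e -> b != e -> c != e ->
  removable [set e; a] -> removable [set e; b] -> removable [set e; c] ->
  removable [set a; b] -> removable [set b; c] -> ~~ removable [set a; c].
Proof.
move=> aH bH cH eH ab bc ac ae be ce rea reb rec rab rbc.
have triple_cut x y : x \in H -> y \in H -> x != y -> x != e -> y != e ->
    removable [set e; x] -> removable [set e; y] -> removable [set x; y] ->
    exists S, cut S H = [set e; x; y].
  move=> xH yH xy xe ye rx ry rxy; apply: (minimal_disconnecting_cut sH).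
  - by apply/set0Pn; exists y; rewrite !inE eqxx orbT.
  - by apply: no_triple; rewrite // eq_sym.
  - move=> z; rewrite !inE -orbA => /or3P [] /eqP ->.
    + apply: removableS rxy; apply/subsetP => t; rewrite !inE.
      by case: (t == e).
    + apply: removableS ry; apply/subsetP => t; rewrite !inE.
      by case: (t == x); rewrite ?orbF.
    + apply: removableS rx; apply/subsetP => t; rewrite !inE.
      by case: (t == y); rewrite ?orbF.
have [S cS] := triple_cut a b aH bH ab ae be rea reb rab.
have [S' cS'] := triple_cut b c bH cH bc be ce reb rec rbc.
apply: (@cut_symdiff_disconnected _ _ _ S S') => //; rewrite ?cS ?cS'.
  move=> x _; rewrite !inE.
  by case: (x == a); case: (x == b); case: (x == c); case: (x == e).
by exists a; rewrite // !inE eqxx (negbTE ab) (negbTE ac) (negbTE ae).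
Qed.

(** In [H :\ e] the edge [f] is still removable, hence lies on a cycle avoiding [e], every edge of
    which is removable together with [e]. Among any three edges of that cycle, some two are
    inseparable. *)
Lemma inseparable_pair e f : e \in H -> f \in H -> e != f ->
  removable [set e; f] -> exists a b,
  [/\ a \in H, b \in H, a != b & ~~ removable [set a; b]] /\
  [/\ a != e, b != e, removable [set e; a] & removable [set e; b]].
Proof.
move=> eH fH ef ref.
have sK : simple_graph V (H :\ e) by apply: simple_graphS sH; apply: subsetDl.
have cK : connectedb V (H :\ e) by apply: removableS ref; rewrite subsetUl.
have fK : f \in H :\ e by rewrite !inE eq_sym ef.
have := removable_edge_cycle sK fK; rewrite setDDl => /(_ ref) [c [c2 uc cc _]].
have subK := cycle_edges_sub cc.
have P x : x \in cycle_edges c -> [/\ x \in H, x != e & removable [set e; x]].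
  move=> xc; have := subsetP subK x xc; rewrite !inE => /andP [xe xH]; split=> //.
  by rewrite /removable -setDDl; apply: cycle_edge_removable subK xc.
have /card_gt2P [x [y [z [[xc yc zc] [xy yz zx]]]]] : 2 < #|cycle_edges c|.
  by rewrite card_cycle_edges.
have [xH xe rx] := P x xc; have [yH ye ry] := P y yc.
have [zH ze rz] := P z zc.
have xz : x != z by rewrite eq_sym.
have [rxy|nxy] := boolP (removable [set x; y]); last first.
  by exists x, y.
have [ryz|nyz] := boolP (removable [set y; z]); last first.
  by exists y, z.
exists x, z; split; split; [exact: xH|exact: zH|exact: xz| |exact: xe|exact: ze| |].
- exact: (inseparable_among_three xH yH zH eH xy yz xz xe ye ze rx ry rz rxy ryz).
- exact: rx.
- exact: rz.
Qed.

(** The previous lemma is used twice: at [e] it gives the inseparable pair [a], [a'], and at [a] it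
    gives the inseparable pair [b], [b']. *)
Lemma crossing_pairs e f : e \in H -> f \in H -> e != f ->
  removable [set e; f] -> exists a a' b b',
  [/\ a \in H, a' \in H, b \in H & b' \in H] /\
  [/\ a != a', b != b', a != b & a' != b'] /\
  [/\ removable [set a; b], removable [set a'; b'],
      ~~ removable [set a; a'] & ~~ removable [set b; b']].
Proof.
move=> eH fH ef /(inseparable_pair eH fH ef).
case=> a [a' [[aH a'H aa' naa'] [ae a'e rea rea']]].
have rae : removable [set a; e] by rewrite setUC.
have [b [b' [[bH b'H bb' nbb'] [ba b'a rab rab']]]] := inseparable_pair aH eH ae rae.
have a'b' : a' != b' by apply: contraNneq naa' => ->.
have ab : a != b by rewrite eq_sym.
exists a, a', b, b'; split; first by split.
split; first by split.
split; [exact: rab| |exact: naa'|exact: nbb'].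
(* If [a'] and [b'] were inseparable, transitivity through [a'] would make [a] and [b'] inseparable
   as well. *)
apply: contraT => na'b'.
have r1 x y : removable [set x; y] -> removable [set x].
  by apply: removableS; rewrite subsetUl.
have r2 x y : removable [set x; y] -> removable [set y].
  by apply: removableS; rewrite subsetUr.
have /negP [] : ~~ removable [set a; b']; last exact: rab'.
have ab' : a != b' by rewrite eq_sym.
apply: (inseparable_trans aH aa' a'b' ab' _ _ _ naa' na'b').
- exact: r1 rab.
- exact: r2 rea'.
- exact: r2 rab'.
Qed.

End TwoRemovableEdges.

(** * Separability and removable pairs *)

Definition no_removable_pair (T : finType) (V : {set T}) (E : {set {set T}}) :=
  forall a b, a \in E -> b \in E -> a != b -> ~~ connectedb V (E :\: [set a; b]).

Import Order.TTheory GRing.Theory Num.Theory.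
Local Open Scope ring_scope.

Lemma big_setD2 (R : nmodType) (I : finType) (A : {set I}) (F : I -> R) a b :
  a \in A -> b \in A -> a != b ->
  \sum_(i in A) F i = F a + F b + \sum_(i in A :\: [set a; b]) F i.
Proof.
move=> aA bA ab; rewrite (big_setD1 a) //= (big_setD1 b) /=; last first.
  by rewrite !inE eq_sym ab.
by rewrite addrA setDDl.
Qed.

Lemma separable_no_removable_pair (R : realType) (T : finType) (V : {set T})
    (E : {set {set T}}) :
  simple_graph V E -> separable R V E -> no_removable_pair V E.
Proof.
move=> sE [w [alpha [_ sep]]] e0 f0 e0E f0E ef0; apply/negP => r0.
(* Connectivity of [F] itself is implied by that of [F] minus two edges. *)
pose P (F : {set {set T}}) :=
  [exists a in F, exists b in F, (a != b) && connectedb V (F :\: [set a; b])].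
have PE : P E.
  by apply/exists_inP; exists e0 => //; apply/exists_inP; exists f0; rewrite ?ef0.
have [H /minsetP [PH minH] sHE] := minset_exists PE.
have /exists_inP [e eH /exists_inP [f fH /andP [ef ref]]] := PH.
have sH : simple_graph V H by apply: simple_graphS sE.
have no3 a b c : a \in H -> b \in H -> c \in H -> a != b -> b != c -> a != c ->
    ~~ connectedb V (H :\: [set a; b; c]).
  move=> aH bH cH ab bc ac; apply/negP => r.
  (* A removable triple would leave a removable pair in [H :\ c], against the minimality of [H]. *)
  have := minH (H :\ c); rewrite subsetDl => /(_ _ isT) hc.
  suff /hc hcE : P (H :\ c) by move: cH; rewrite -hcE !inE eqxx.
  apply/exists_inP; exists a; first by rewrite !inE ac.
  apply/exists_inP; exists b; first by rewrite !inE bc.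
  by rewrite ab setDDl setUC.
have [a [a' [b [b' [[aH a'H bH b'H] [[aa' bb' ab a'b'] [rab ra'b' naa' nbb']]]]]]] :=
  crossing_pairs sH no3 eH fH ef ref.
have sub X : H :\: X \subset E by apply: subset_trans sHE; apply: subsetDl.
have ge X : connectedb V (H :\: X) -> alpha <= \sum_(i in H :\: X) w i.
  by move/connectedP/(sep _ (sub X)).
have lt X : ~~ connectedb V (H :\: X) -> \sum_(i in H :\: X) w i < alpha.
  by apply: contraNT; rewrite -leNgt => /(sep _ (sub X)) /connectedP.
move: (ge _ rab) (ge _ ra'b') (lt _ naa') (lt _ nbb').
(* The two connected remainders and the two disconnected ones have the same total weight, twice that
   of [H] minus the weights of [a], [a'], [b], [b']; yet the former reach [2 * alpha] and the latter
   stay below it. *)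
have := big_setD2 w aH bH ab; have := big_setD2 w a'H b'H a'b'.
have := big_setD2 w aH a'H aa'; have := big_setD2 w bH b'H bb'.
set s := \sum_(i in H) _; set s1 := bigop _ _ _; set s2 := bigop _ _ _.
set s3 := bigop _ _ _; set s4 := bigop _ _ _.
lra.
Qed.

Lemma no_removable_pair_separable (R : realType) (T : finType) (V : {set T})
    (E : {set {set T}}) :
  connectedb V E -> no_removable_pair V E -> separable R V E.
Proof.
move=> cE nE.
pose w (a : {set T}) : R := if connectedb V (E :\ a) then 1 else 2.
have w1 a : 1 <= w a by rewrite /w; case: ifP => _; rewrite ?lexx // ler1n.
exists w, (\sum_(a in E) w a - 1); split.
  by move=> a _; exact: le_trans ler01 (w1 a).
move=> F sFE; rewrite (big_setID F) /= (setIidPr sFE).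
have FE : F = E :\: (E :\: F) by rewrite setDDr setDv set0U (setIidPr sFE).
(* The threshold condition now says that the missing edges [E :\: F] weigh at most 1. The cases are:
   none missing, exactly one, at least two. *)
rewrite -addrA gerDl subr_le0.
have [X0|[a aX]] := set_0Vmem (E :\: F).
  rewrite X0 big_set0 ler01; split=> // _; apply/connectedP.
  by rewrite FE X0 setD0.
have [X1|[b]] := set_0Vmem (E :\: F :\ a).
  have XE : E :\: F = [set a] by rewrite -(setD1K aX) X1 setU0.
  rewrite {2}FE XE big_set1 /w.
  split; first by case: ifP => [/connectedP //|]; rewrite lern1.
  by move/connectedP => ->.
rewrite in_setD1 => /andP [ba bX].
have [aE bE] : a \in E /\ b \in E.
  by move: aX bX; rewrite !inE => /andP[_ ->] /andP[_ ->].
split.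
  rewrite (big_setD1 a) //= (big_setD1 b) /=; last by rewrite in_setD1 ba.
  have : 0 <= \sum_(i in E :\: F :\ a :\ b) w i.
    by apply: sumr_ge0 => i _; exact: le_trans ler01 (w1 i).
  by have := w1 a; have := w1 b; lra.
move/connectedP; rewrite {1}FE => cF.
have ab : a != b by rewrite eq_sym.
have /negP [] := nE a b aE bE ab.
by apply: connectedS cF; apply: setDS; apply/subsetP => x /set2P [] ->.
Qed.

(** * Structure of a connected graph with a cycle and no removable pair *)

Lemma long_seq_mem (T : eqType) (s : seq T) : (2 < size s)%N -> exists x, x \in s.
Proof. by case: s => [|x s] // _; exists x; rewrite mem_head. Qed.

Section Arborescences.
Variables (T : finType) (V : {set T}) (E : {set {set T}}).
Hypotheses (sE : simple_graph V E) (cE : connectedb V E).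
Hypothesis nE : no_removable_pair V E.
Variable c : seq T.
Hypotheses (c2 : (2 < size c)%N) (uc : uniq c) (cc : cycle (adj E) c).

Let E' := E :\: cycle_edges c.

Let sub_cE : cycle_edges c \subset E := cycle_edges_sub cc.

Lemma cycle_sub_vertices : [set:: c] \subset V.
Proof.
apply/subsetP => x; rewrite inE => xc.
by have [] := adj_V sE (next_cycle cc xc).
Qed.

(** A second cycle sharing no edge with [c] would allow one edge of each to be removed, one after
    the other. *)
Lemma off_cycle_acyclic : acyclic E'.
Proof.
move=> d d2 /andP [cd ud].
have [x xc] := long_seq_mem c2.
have [y yd] := long_seq_mem d2.
have subd := cycle_edges_sub cd.
have xE := cycle_edge xc; have yE := cycle_edge yd.
have yE' := subsetP subd _ yE; move: (yE'); rewrite inE => /andP [yc yE''].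
have xy : [set x; next c x] != [set y; next d y].
  by apply: contraNneq yc => <-.
have /negP [] := nE (subsetP sub_cE _ xE) yE'' xy.
rewrite -setDDl; apply: cycle_edge_removable yE => //.
  exact: cycle_edge_removable xE.
apply: subset_trans subd _; apply/subsetP => a; rewrite !inE => /andP [ac ->].
by rewrite andbT; apply: contraNneq ac => ->.
Qed.

(** Otherwise the edges leaving [x] and [y] on [c] form a removable pair: once the first is deleted,
    the arc from [next c y] to [x] followed by the off-cycle path to [y] replaces the second. *)
Lemma off_cycle_separated x y :
  x \in c -> y \in c -> connect (adj E') x y -> x = y.
Proof.
move=> xc yc cxy; apply/eqP; apply: contraT => xy.
have xE := cycle_edge xc; have yE := cycle_edge yc.
have exy : [set x; next c x] != [set y; next c y].
  by apply: contraNneq xy => /cycle_edge_inj ->.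
have /negP [] := nE (subsetP sub_cE _ xE) (subsetP sub_cE _ yE) exy.
rewrite -setDDl; apply: connectedD1; first exact: cycle_edge_removable xE.
rewrite connect_adj_sym; apply: (@connect_trans _ _ x).
  apply: connect_adjS (arc_connect uc xc yc).
  apply/subsetP => _ /imsetP [z + ->]; rewrite inE => /and3P [zc zx zy].
  rewrite !inE (subsetP sub_cE _ (cycle_edge zc)) andbT.
  by apply/andP; split; apply/eqP => /cycle_edge_inj eqz;
    move: zx zy; rewrite eqz ?eqxx.
apply: connect_adjS cxy; apply/subsetP => a; rewrite !inE => /andP [ac ->].
by rewrite andbT; apply/andP; split; apply: contraNneq ac => ->.
Qed.

Lemma off_cycle_cover v : v \in V -> exists2 x, x \in c & connect (adj E') x v.
Proof.
move=> Vv; pose S := [pred v | [exists x in c, connect (adj E') x v]].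
(* An edge of [c] ends on [c], which restarts the off-cycle path there; any other edge prolongs
   it. *)
have cl : closed (adj E) S.
  apply: closed_adj => y z yz; rewrite !inE => /exists_inP [x xc xy].
  have [/cycle_edge_sub|nyz] := boolP ([set y; z] \in cycle_edges c).
    rewrite subUset !sub1set !inE => /andP [_ zc].
    by apply/exists_inP; exists z.
  apply/exists_inP; exists x => //; apply: connect_trans xy _.
  by apply: connect1; rewrite /adj /= inE nyz.
have [x xc] := long_seq_mem c2.
have Vx : x \in V by apply: (subsetP cycle_sub_vertices); rewrite inE.
have Sx : x \in S by rewrite inE; apply/exists_inP; exists x.
move/connectedP: cE => /(_ x v Vx Vv) /(closed_connect cl).
by rewrite Sx => /esym /exists_inP.
Qed.

Let hanging x := [set v | connect (adj E') x v].

Lemma hanging_sub x : x \in V -> hanging x \subset V.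
Proof.
move=> Vx; apply/subsetP => v; rewrite inE => xv.
have cl : closed (adj E) V by apply: closed_adj => y z /(adj_V sE) [].
by rewrite -(closed_connect cl (connect_adjS (subsetDl _ _) xv)).
Qed.

Let hanging_edges x := [set a in E' | a \subset hanging x].

Lemma hanging_tree x : tree (hanging x) (hanging_edges x).
Proof.
have sE' : hanging_edges x \subset E.
  by apply/subsetP => a; rewrite !inE => /andP [/andP []].
split.
- move=> a aE; have [_ ->] := sE (subsetP sE' _ aE).
  by move: aE; rewrite inE => /andP [].
(* A path of [E'] starting at [x] stays in the component of [x], so all its edges are in
   [hanging_edges x]. *)
- have H y : connect (adj E') x y -> connect (adj (hanging_edges x)) x y.
    move=> xy; pose A := [pred v | connect (adj (hanging_edges x)) x v].
    suff cl : closed (adj E') A.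
      by have := closed_connect cl xy; rewrite !inE connect0 => <-.
    apply: closed_adj => u v uv; rewrite !inE => xu.
    apply: connect_trans (xu) _; apply: connect1.
    have xu' : connect (adj E') x u.
      by apply: connect_adjS xu; apply/subsetP => a; rewrite inE => /andP [].
    rewrite /adj /= inE -[_ \in E']/(adj E' u v) uv subUset !sub1set !inE xu' /=.
    exact: connect_trans xu' (connect1 uv).
  move=> u v; rewrite !inE => /H xu /H xv.
  by apply: connect_trans xv; rewrite connect_adj_sym.
- move=> d d2 /andP [cd ud]; apply: (off_cycle_acyclic d2).
  rewrite /ucycle ud andbT; apply: sub_cycle cd => u v.
  by rewrite /adj /= inE => /andP [].
Qed.

Lemma off_cycle_edge a : a \in E' ->
  exists2 x, x \in c & (1 < #|hanging x|)%N && (a \subset hanging x).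
Proof.
move=> aE'; have aE : a \in E by move: aE'; rewrite inE => /andP [].
have [u [v [uv ae Vu _]]] := simple_edge sE aE.
have [x xc xu] := off_cycle_cover Vu; exists x => //.
have aS : a \subset hanging x.
  rewrite ae subUset !sub1set !inE xu; apply: connect_trans xu _.
  by apply: connect1; rewrite /adj /= -ae.
rewrite aS andbT; apply: leq_trans (subset_leq_card aS).
by have [_ ->] := sE aE.
Qed.

Lemma unicyclic_structure : elementary_cycle V E \/ cycle_with_arborescences V E.
Proof.
have Ec : elementary_cycle [set:: c] (cycle_edges c) by exists c.
(* Only nontrivial components count as trees, so [B] indexes the arborescences; when it is empty the
   graph is the bare cycle. *)
pose B := [set x in [set:: c] | (1 < #|hanging x|)%N].
have inB x : x \in c -> (1 < #|hanging x|)%N -> x \in B.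
  by move=> xc hx; rewrite !inE xc.
have EU : E = cycle_edges c :|: E'.
  by rewrite -{1}(setID E (cycle_edges c)) (setIidPr sub_cE).
have [B0|[x0 Bx0]] := set_0Vmem B.
  left; have E'0 : E' = set0.
    apply/eqP; rewrite -subset0; apply/subsetP => a.
    case/off_cycle_edge => x xc /andP [hx _].
    by have := inB x xc hx; rewrite B0 inE.
  suff VE : V = [set:: c] by rewrite VE EU E'0 setU0.
  apply/eqP; rewrite eqEsubset cycle_sub_vertices andbT; apply/subsetP => v.
  case/off_cycle_cover => x xc xv; rewrite inE.
  have [<- //|xv'] := eqVneq x v.
  suff /(inB x xc) : (1 < #|hanging x|)%N by rewrite B0 inE.
  by apply/card_gt1P; exists x, v; rewrite !inE connect0.
right; pose r (i : 'I_#|B|) : T := enum_val i.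
have rc i : r i \in c by have := enum_valP i; rewrite !inE => /andP [].
exists [set:: c], (cycle_edges c), #|B|, r, (hanging \o r), (hanging_edges \o r).
split=> //=.
- by apply/card_gt0P; exists x0.
- move=> i; split; first exact: hanging_tree.
    by have := enum_valP i; rewrite !inE => /andP [].
  apply/setP => v; rewrite !inE; apply/andP/eqP => [[h vc]|->].
    by apply/esym; apply: off_cycle_separated h.
  by rewrite connect0.
(* Here the trees are fully disjoint: a common vertex would join two distinct vertices of [c] off
   the cycle. *)
- move=> i j ij; apply/subsetP => v; rewrite !inE => /andP [hi hj].
  have : r i = r j.
    apply: off_cycle_separated => //; apply: connect_trans hi _.
    by rewrite connect_adj_sym.
  by move/enum_val_inj => eij; rewrite eij eqxx in ij.
have bigP x : x \in B -> exists i, r i = x.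
  by move=> xB; exists (enum_rank_in xB x); rewrite /r enum_rankK_in.
split; apply/eqP; rewrite eqEsubset; apply/andP; split.
- apply/subsetP => v /off_cycle_cover [x xc xv]; rewrite inE.
  have [<-|xv'] := eqVneq x v; first by rewrite inE xc.
  have /(inB x xc) /bigP [i ri] : (1 < #|hanging x|)%N.
    by apply/card_gt1P; exists x, v; rewrite !inE connect0.
  by apply/orP; right; apply/bigcupP; exists i => //=; rewrite ri inE.
- rewrite subUset cycle_sub_vertices; apply/bigcupsP => i _ /=.
  by apply/hanging_sub/(subsetP cycle_sub_vertices); rewrite inE.
- rewrite {1}EU; apply: setUS; apply/subsetP => a aE'.
  have [x xc /andP [/(inB x xc) /bigP [i ri] ax]] := off_cycle_edge aE'.
  by apply/bigcupP; exists i => //=; rewrite inE aE' ri.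
- rewrite subUset sub_cE; apply/bigcupsP => i _ /=.
  by apply/subsetP => a; rewrite !inE => /andP [/andP []].
Qed.

End Arborescences.

(** * Absence of removable pairs in trees and in graphs with one cycle *)

(** A vertex set grown from one vertex along edges leaving it gains at least one inner edge with
    each new vertex. The successor on the right also covers empty [V]. *)
Lemma connected_card (T : finType) (V : {set T}) (F : {set {set T}}) :
  (forall a, a \in F -> a \subset V) -> connectedb V F -> (#|V| <= #|F|.+1)%N.
Proof.
move=> sF cF; have [->|[x0 Vx0]] := set_0Vmem V; first by rewrite cards0.
suff grow k : (k < #|V|)%N -> exists S : {set T},
    [/\ x0 \in S, S \subset V, #|S| = k.+1 & (k <= #|[set a in F | a \subset S]|)%N].
  have V0 : (#|V|.-1 < #|V|)%N by rewrite prednK //; apply/card_gt0P; exists x0.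
  have [S [_ _ _ le]] := grow _ V0.
  rewrite -(ltn_predK V0) ltnS; apply: leq_trans le (subset_leq_card _).
  by apply/subsetP => a; rewrite inE => /andP [].
elim: k => [_|k IH lt].
  by exists [set x0]; rewrite set11 sub1set Vx0 cards1.
have [S [Sx0 sSV cS le]] := IH (ltnW lt).
have [y Vy nSy] : exists2 y, y \in V & y \notin S.
  apply/subsetPn; apply/negP => /subset_leq_card.
  by rewrite cS leqNgt lt.
(* Some edge leaves [S]; otherwise [S] would be closed and [y] unreachable from [x0]. *)
have [/exists_inP [u Su /existsP [v /andP [nSv uv]]]|] :=
    boolP [exists u in S, exists v, (v \notin S) && adj F u v]; last first.
  rewrite negb_exists_in => /forall_inP nuv.
  suff cl : closed (adj F) S.
    move/connectedP: cF => /(_ x0 y Vx0 Vy) /(closed_connect cl).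
    by rewrite Sx0 (negbTE nSy).
  apply: closed_adj => u v uv /nuv; rewrite negb_exists => /forallP /(_ v).
  by rewrite uv andbT negbK.
have Vv : v \in V by have := sF _ uv; rewrite subUset !sub1set => /andP [].
exists (v |: S); split.
- by rewrite !inE Sx0 orbT.
- by rewrite subUset sub1set Vv.
- by rewrite cardsU1 nSv cS.
have nuv : [set u; v] \notin [set a in F | a \subset S].
  by rewrite inE subUset !sub1set (negbTE nSv) !andbF.
apply: leq_ltn_trans le _.
have := cardsU1 [set u; v] [set a in F | a \subset S]; rewrite nuv add1n => <-.
apply: subset_leq_card; rewrite subUset sub1set inE (uv : _ \in F) /=.
rewrite subUset !sub1set !inE Su eqxx orbT /=; apply/subsetP => a.
by rewrite !inE => /andP [-> aS]; apply: subset_trans aS (subsetUr _ _).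
Qed.

(** A cycle has as many edges as vertices, so removing two leaves fewer than connectivity
    requires. *)
Lemma elementary_cycle_no_removable_pair (T : finType) (V : {set T})
    (E : {set {set T}}) : elementary_cycle V E -> no_removable_pair V E.
Proof.
case=> c [c2 uc -> ->] a b; rewrite -/(cycle_edges c) => aE bE ab.
apply/negP => cE; suff : (#|cycle_edges c :\: [set a; b]|.+1 < #|[set:: c]|)%N.
  rewrite ltnNge connected_card // => e.
  by rewrite inE => /andP [_]; apply: cycle_edge_sub.
have -> : #|[set:: c]| = #|cycle_edges c|.
  by rewrite (card_cycle_edges c2 uc) cardsE; apply/card_uniqP.
rewrite (cardsD1 a (cycle_edges c)) aE (cardsD1 b (_ :\ a)) in_setD1 eq_sym ab bE.
by rewrite setDDl.
Qed.

Lemma elementary_cycle_edge_sub (T : finType) (V : {set T}) (E : {set {set T}}) a :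
  elementary_cycle V E -> a \in E -> a \subset V.
Proof. by case=> c [_ _ -> ->]; apply: cycle_edge_sub. Qed.

(** Tree edges are bridges of the whole graph, and for two cycle edges the graph retracts onto its
    cycle by sending each tree to its root. *)
Lemma cycle_with_arborescences_no_removable_pair (T : finType) (V : {set T})
    (E : {set {set T}}) : cycle_with_arborescences V E -> no_removable_pair V E.
Proof.
case=> VC [EC [n [r [VT [ET [cyc _ trees disj [VE EE]]]]]]].
have subC a : a \in EC -> a \subset VC by apply: elementary_cycle_edge_sub.
have subT i a : a \in ET i -> a \subset VT i.
  by move=> aE; have [[/(_ a aE) []]] := trees i.
have rP i u : u \in VT i -> u \in VC -> u = r i.
  move=> ui uC; have [_ _ /setP /(_ u)] := trees i.
  by rewrite !inE ui uC => /esym /eqP.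
have rT i : r i \in VT i /\ r i \in VC.
  by have [_ _ /setP /(_ (r i))] := trees i; rewrite !inE eqxx => /andP.
have rTT i j u : u \in VT i -> u \in VT j -> i = j \/ u = r i /\ u = r j.
  move=> ui uj; have [->|ij] := eqVneq i j; [by left|right].
  have uC : u \in VC by apply: (subsetP (disj i j ij)); rewrite inE ui.
  by split; apply: rP.
have edgeP a : a \in E -> a \in EC \/ exists i, a \in ET i.
  rewrite EE inE => /orP [->|/bigcupP [i _ ai]]; [by left|by right; exists i].
have subVC : VC \subset V by rewrite VE subsetUl.
have subVT i : VT i \subset V.
  rewrite VE; apply: subset_trans (subsetUr _ _).
  exact: (bigcup_max i).
have pairP u v (A : {set T}) : [set u; v] \subset A -> u \in A /\ v \in A.
  by rewrite subUset !sub1set => /andP.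
have bridge i a : a \in ET i -> ~~ connectedb V (E :\ a).
  move=> ai; have [Ti _ _] := trees i; have := tree_edge_bridge Ti ai.
  apply: contra => cE; have [ri _] := rT i.
  (* All vertices outside the tree belong to [S]. It is closed because the tree can only be entered
     at [r i]; hence a connected [E :\ a] would keep the tree connected without [a]. *)
  pose S := [pred v | (v \in VT i) ==> connect (adj (ET i :\ a)) (r i) v].
  have cl : closed (adj (E :\ a)) S.
    apply: closed_adj => u v; rewrite /adj /= !inE => /andP [na uv] Su.
    apply/implyP => vi; have [uvi|nuvi] := boolP ([set u; v] \in ET i).
      have [ui _] := pairP _ _ _ (subT _ _ uvi).
      apply: connect_trans (implyP Su ui) _; apply: connect1.
      by rewrite /adj /= !inE na.
    suff -> : v = r i by exact: connect0.
    case: (edgeP _ uv) => [/subC/pairP [_ vC]|[j uvj]]; first exact: rP.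
    have [_ vj] := pairP _ _ _ (subT _ _ uvj).
    case: (rTT i j v vi vj) => [ij|[]//].
    by move: nuvi; rewrite ij uvj.
  have reach v : v \in VT i -> connect (adj (ET i :\ a)) (r i) v.
    move=> vi; move/connectedP: cE.
    move/(_ _ _ (subsetP (subVT i) _ ri) (subsetP (subVT i) _ vi)).
    by move/(closed_connect cl); rewrite !inE connect0 vi implybT.
  apply/connectedP => u v ui vi; apply: connect_trans (reach v vi).
  by rewrite connect_adj_sym; apply: reach.
move=> a b aE bE ab.
case: (edgeP _ aE) => [aC|[i /bridge]]; last first.
  by apply: contra; apply: connectedS; rewrite -setDDl subsetDl.
case: (edgeP _ bE) => [bC|[i /bridge]]; last first.
  by apply: contra; apply: connectedS; rewrite setUC -setDDl subsetDl.
have := elementary_cycle_no_removable_pair cyc aC bC ab.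
apply: contra => cE; apply/connectedP => x y xC yC.
set F := EC :\: _.
(* A vertex belongs to [S] when its image under the retraction is reachable from [x] along the rest
   of the cycle. *)
pose S := [pred v | (v \in VC) && connect (adj F) x v ||
                    [exists i, (v \in VT i) && connect (adj F) x (r i)]].
have SC v : v \in S -> v \in VC -> connect (adj F) x v.
  rewrite inE => /orP [/andP [] //|/existsP [i /andP [vi xr]]] vC.
  by rewrite (rP i v).
have ST v i : v \in S -> v \in VT i -> connect (adj F) x (r i).
  rewrite inE => /orP [/andP [vC xv] vi|/existsP [j /andP [vj xr]] vi].
    by rewrite -(rP i v).
  by case: (rTT i j v vi vj) => [->|[<- ->]].
have cl : closed (adj (E :\: [set a; b])) S.
  apply: closed_adj => u v; rewrite /adj /= inE => /andP [nab uv] Su.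
  rewrite inE; case: (edgeP _ uv) => [uvC|[i /subT/pairP [ui vi]]].
    have [uC vC] := pairP _ _ _ (subC _ uvC).
    rewrite vC; apply/orP; left; apply: connect_trans (SC u Su uC) _.
    by apply: connect1; rewrite /adj /= inE nab.
  by apply/orP; right; apply/existsP; exists i; rewrite vi (ST u).
apply: SC => //.
have := connectedP _ _ cE x y (subsetP subVC _ xC) (subsetP subVC _ yC).
by move/(closed_connect cl) => <-; rewrite inE xC connect0.
Qed.

Lemma tree_no_removable_pair (T : finType) (V : {set T}) (E : {set {set T}}) :
  tree V E -> no_removable_pair V E.
Proof.
move=> tE a b aE _ _; apply: contra (tree_edge_bridge tE aE).
by apply: connectedS; rewrite -setDDl subsetDl.
Qed.

(** No edge subset is connected here, so a threshold that zero weights never reach is enough. *)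
Lemma disconnected_separable (R : realType) (T : finType) (V : {set T})
    (E : {set {set T}}) : ~~ connectedb V E -> separable R V E.
Proof.
move=> dE; exists (fun=> 0), 1; split=> // F sFE; rewrite big1 // ler10.
split=> // /connectedP cF; by rewrite (connectedS sFE cF) in dE.
Qed.

Theorem theorem6 (R : realType) (T : finType) (V : {set T}) (E : {set {set T}})
    (hG : simple_graph V E) :
  separable R V E <->
  [\/ ~ graph_connected V E, tree V E, elementary_cycle V E
    | cycle_with_arborescences V E].
Proof.
have [cE|dE] := boolP (connectedb V E); last first.
  by split=> _; [constructor 1; apply/connectedP|apply: disconnected_separable].
split=> [/(separable_no_removable_pair hG) nE|].
  (* A connected graph is a tree or contains a cycle, to which the structure result applies. *)
  have [acE|/existsNP [c /not_implyP [c2 /contrapT /andP [cc uc]]]] :=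
    pselect (acyclic E).
    by constructor 2; split=> //; apply/connectedP.
  have [] := unicyclic_structure hG cE nE c2 uc cc; first by constructor 3.
  by constructor 4.
move=> kind; apply: no_removable_pair_separable => //.
case: kind => [/connectedP|/tree_no_removable_pair|
  /elementary_cycle_no_removable_pair|
  /cycle_with_arborescences_no_removable_pair] //.
by rewrite cE.
Qed.
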